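(* Let $(f,g)$ be consistent Cauchy data, $\varphi_1\in\mathcal{H}$, and for $\varepsilon>0$ let $z_\varepsilon\in\mathcal{H}$ satisfy $\|z_\varepsilon-z_{f,g}\|\le\varepsilon$. Let $\varphi_1^\varepsilon:=\varphi_1$ and $\varphi_{k+1}^\varepsilon:=T_l\varphi_k^\varepsilon+z_\varepsilon$ for $k=1,2,\dots$. If $\mu>1$ is fixed, then the stopping index determined by the discrepancy principle, $$k(\varepsilon,z_\varepsilon):=\min\{k\in\mathbb{N}\ :\ \|z_\varepsilon-(I-T_l)\varphi_k^\varepsilon\|\le\mu\varepsilon\},$$ satisfies $k(\varepsilon,z_\varepsilon)=O(\varepsilon^{-2})$ as $\varepsilon\to0$.
   Context: Setting. $\Omega\subset\mathbb{R}^2$ is an open bounded regular set and $\partial\Omega$ is split into $\Gamma_1,\Gamma_2$ with $\Gamma_1\cap\Gamma_2=\emptyset$ and $\overline{\Gamma_1\cup\Gamma_2}=\partial\Omega$. $P u=-\sum_{i,j=1}^2 D_i(a_{i,j}D_ju)$ with coefficients $a_{i,j}\in L_\infty(\Omega)$ such that $\xi^t(a_{i,j}(x))\xi>\alpha\|\xi\|^2$ for a.e. $x\in\Omega$ and all nonzero $\xi\in\mathbb{R}^2$, with $\alpha>0$ independent of $x$. $u_{\nu_A}$ denotes the conormal derivative associated with $P$. Cauchy data $(f,g)\in H^{1/2}(\Gamma_1)\times H^{1/2}_{00}(\Gamma_1)'$ are consistent if there is an $H^1(\Omega)$-solution $u$ (it is then unique) of $Pu=0$ in $\Omega$, $u=f$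 and $u_{\nu_A}=g$ at $\Gamma_1$. Operator. Let $\mathcal{H}:=H^{1/2}_{00}(\Gamma_2)'$. Define $L_n:\mathcal{H}\to H^{1/2}(\Gamma_2)$, $L_n(\varphi)=w|_{\Gamma_2}$, where $w\in H^1(\Omega)$ solves $Pw=0$ in $\Omega$, $w=f$ at $\Gamma_1$, $w_{\nu_A}=\varphi$ at $\Gamma_2$; and $L_d:H^{1/2}(\Gamma_2)\to\mathcal{H}$, $L_d(\psi)=v_{\nu_A}|_{\Gamma_2}$, where $v\in H^1(\Omega)$ solves $Pv=0$ in $\Omega$, $v_{\nu_A}=g$ at $\Gamma_1$, $v=\psi$ at $\Gamma_2$. Set $T:=L_d\circ L_n:\mathcal{H}\to\mathcal{H}$. $T$ is affine, $T\varphi=T_l\varphi+z_{f,g}$, with linear part $T_l$ and affine term $z_{f,g}\in\mathcal{H}$. For consistent data the equation $T\varphi=\varphi$ has the unique solution $\bar\varphi=u_{\nu_A}|_{\Gamma_2}$. Norm. For $\varphi\in\mathcal{H}$ let $W(\varphi)\in H^1(\Omega)$ solve $Pw=0$ in $\Omega$, $w=0$ at $\Gamma_1$, $w_{\nu_A}=\varphi$ at $\Gamma_2$. $\mathcal{H}$ carries the inner product $\langle\varphi,\psi\rangle_*=\int_\Omega\nabla W(\varphi)\cdot\nabla W(\psi)\,dx$; $\|\cdot\|$ denotes the induced norm, which is equivalent to the usual norm of $\mathcal{H}$. It is known from earlier work that $T_l$ is self-adjoint, non-negative and non-expansive for this inner product and that $\mathrm{Ker}(I-T_l)=\{0\}$.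 Convention. The constant in $O(\varepsilon^{-2})$ does not depend on $\varepsilon$ or on the choice of $z_\varepsilon$. *)

(* Defs.v *)
From HB Require Import structures.
From mathcomp Require Import all_boot all_order all_algebra generic_quotient.
From mathcomp Require Import ring lra.
From mathcomp Require Import all_classical all_reals all_analysis.
From mathcomp Require Import measurable_realfun ess_sup_inf.

Set Implicit Arguments.
Unset Strict Implicit.
Unset Printing Implicit Defensive.

Import Order.TTheory GRing.Theory Num.Theory numFieldNormedType.Exports.
Local Open Scope classical_set_scope.
Local Open Scope ring_scope.

Section Plane.
Variable R : realType.

Notation plane := (measurableTypeR R * measurableTypeR R)%type.

Definition unit_vec (i : 'I_2) : R * R := ((i == 0)%:R, (i == 1)%:R).

Definition partial (i : 'I_2) (f : R * R -> R) : R * R -> R :=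
  fun x => 'D_(unit_vec i) f x.

Fixpoint Cn (n : nat) (f : R * R -> R) : Prop :=
  if n is m.+1 then
    [/\ continuous f,
        forall i x, derivable f x (unit_vec i)
      & forall i, Cn m (partial i f)]
  else continuous f.

Definition smooth (f : R * R -> R) : Prop := forall n, Cn n f.

Lemma Cn_continuous n f : Cn n f -> continuous f.
Proof. by case: n => [//|n] []. Qed.

Lemma Cn_0 n : Cn n 0.
Proof.
have c0 : continuous (0 : R * R -> R) by exact: cst_continuous.
elim: n => [//|n ih]; split => // i.
by rewrite (_ : partial i 0 = 0)//; apply/funext => x; exact: derive_cst.
Qed.

Lemma Cn_lin n (a : R) (f g : R * R -> R) :
  Cn n f -> Cn n g -> Cn n (a *: f + g).
Proof.
have clin (u v : R * R -> R) :
    continuous u -> continuous v -> continuous (a *: u + v).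
  by move=> cu cv x; apply: cvgD; [apply: cvgZr; exact: cu|exact: cv].
elim: n f g => [|n ih] f g; first exact: clin.
move=> [cf df Cf] [cg dg Cg]; split; first exact: clin.
- by move=> i x; apply: derivableD => //; exact: derivableZ.
- move=> i; suff -> : partial i (a *: f + g) = a *: partial i f + partial i g.
    by apply: ih; [exact: Cf|exact: Cg].
  apply/funext => x; rewrite /partial deriveD//; last exact: derivableZ.
  by rewrite deriveZ.
Qed.

Definition supp (f : R * R -> R) : set (R * R) := closure [set x | f x != 0].

Definition test_function (U : set (R * R)) (f : R * R -> R) : Prop :=
  [/\ smooth f, compact (supp f) & supp f `<=` U].

Definition bdry (U : set (R * R)) : set (R * R) := closure U `\` interior U.

(* Near each boundary point, in some rotated orthonormal frame, U is the
   strict epigraph of a Lipschitz function. *)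
Definition lipschitz_boundary (U : set (R * R)) : Prop :=
  forall p, bdry U p ->
  exists (c s : R) (h : R -> R),
    [/\ c ^+ 2 + s ^+ 2 = 1, lipschitz h
      & \forall x \near p,
          U x <-> h (c * x.1 + s * x.2) < c * x.2 - s * x.1].

Record regular_domain := RegularDomain {
  dom :> set (R * R);
  dom_open : open dom;
  dom_bounded : bounded_set dom;
  dom_lipschitz : lipschitz_boundary dom }.

Lemma open_measurable_plane (U : set (R * R)) :
  open U -> measurable (U : set plane).
Proof.
move=> oU.
pose box (q : (rat * rat) * (rat * rat)) : set (R * R) :=
  `](ratr q.1.1 : R), ratr q.1.2[%classic `*`
  `](ratr q.2.1 : R), ratr q.2.2[%classic.
pose Q := [set q | box q `<=` U].
have -> : (U : set plane) = \bigcup_(q in Q) (box q : set plane).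
  apply/seteqP; split => [[x y] Uxy|[x y] [q Qq]]; last exact: Qq.
  have [[A B]/= [Ax By] ABU] : nbhs (x, y) U by apply: open_nbhs_nbhs; split.
  move: Ax By => /nbhs_ballP[e /= e0 xA] /nbhs_ballP[d /= d0 yB].
  have [q1] : exists q : rat, ratr q \in `](x - e), x[.
    have /rat_in_itvoo[q ?] : x - e < x by rewrite ltrBlDr ltrDl.
    by exists q.
  have [q2] : exists q : rat, ratr q \in `]x, (x + e)[.
    have /rat_in_itvoo[q ?] : x < x + e by rewrite ltrDl.
    by exists q.
  have [q3] : exists q : rat, ratr q \in `](y - d), y[.
    have /rat_in_itvoo[q ?] : y - d < y by rewrite ltrBlDr ltrDl.
    by exists q.
  have [q4] : exists q : rat, ratr q \in `]y, (y + d)[.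
    have /rat_in_itvoo[q ?] : y < y + d by rewrite ltrDl.
    by exists q.
  rewrite !in_itv/= => /andP[y1 y2] /andP[y3 y4] /andP[x1 x2] /andP[x3 x4].
  exists ((q1, q2), (q3, q4)) => /=; last first.
    by split; rewrite /= in_itv/=; apply/andP.
  move=> [a b] /= [].
  rewrite /= !in_itv/= => /andP[a1 a2] /andP[b1 b2].
  apply: ABU; split => /=.
    apply: xA; rewrite /ball/= ltr_distlC.
    by rewrite (lt_trans _ a1) ?(lt_trans a2).
  apply: yB; rewrite /ball/= ltr_distlC.
  by rewrite (lt_trans _ b1) ?(lt_trans b2).
rewrite bigcup_mkcond; apply: countable_bigcupT_measurable => // q.
by case: ifP => // _; exact: measurableX.
Qed.

Definition mu_plane : {measure set plane -> \bar R} :=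
  (@lebesgue_measure R \x @lebesgue_measure R)%E.

(* Lebesgue measure of the plane restricted to the domain: integrals against
   it over the whole plane are integrals over the domain. *)
Definition mu_dom (Om : regular_domain) : {measure set plane -> \bar R} :=
  mrestr mu_plane (open_measurable_plane (@dom_open Om)).

End Plane.

Section Sobolev.
Variables (R : realType) (Om : regular_domain R).

Notation mu := (mu_dom Om).
Notation plane := (measurableTypeR R * measurableTypeR R)%type.

Lemma dom_box : exists M : R, forall x, dom Om x -> `|x| <= M.
Proof.
have [M [_ OmM]] := @dom_bounded _ Om.
exists (M + 1) => x Omx; apply: (OmM (M + 1)) => //.
by rewrite ltrDl.
Qed.

Lemma mu_dom_fin : mu [set: plane] \is a fin_num.
Proof.
have [M OmM] := dom_box.
rewrite ge0_fin_numE//= /mu_dom /mrestr setTI.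
pose B : set plane := `[- M, M]%classic `*` `[- M, M]%classic.
apply: (@le_lt_trans _ _ (mu_plane R B)).
  apply: le_measure; rewrite ?inE.
  - exact: open_measurable_plane (@dom_open _ Om).
  - exact: measurableX.
  - move=> [x y] /OmM; rewrite prod_normE /= ge_max => /andP[xM yM].
    by split; rewrite /= in_itv/= -ler_norml.
pose I : set (measurableTypeR R) := `[- M, M]%classic.
have fM : (lebesgue_measure I < +oo :> \bar R)%E.
  by rewrite /I lebesgue_measure_itv/=; case: ifP => // _; rewrite -EFinB ltry.
have -> : mu_plane R B =
    (lebesgue_measure I * lebesgue_measure I)%E.
  exact: product_measure1E.
by rewrite lte_mul_pinfty// ge0_fin_numE.
Qed.

Lemma continuous_measurable_plane (f : R * R -> R) :
  continuous f -> measurable_fun [set: plane] (f : plane -> R).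
Proof.
move=> /continuousP cf.
apply: (measurability _ (RGenOpens.measurableE R)).
move=> _ [_ [a [b ->] <-]]; rewrite setTI; apply: open_measurable_plane.
exact/cf/interval_open.
Qed.

Lemma continuous_Lfun2 (f : R * R -> R) : continuous f -> f \in Lfun mu 2%:E.
Proof.
move=> cf; have mf := continuous_measurable_plane cf.
have [M OmM] := dom_box.
pose B : set (R * R) := `[- M, M]%classic `*` `[- M, M]%classic.
have cB : compact B by apply: compact_setX; exact: segment_compact.
have /compact_bounded[N [_ fN]] : compact (f @` B).
  by apply: continuous_compact => //; exact: continuous_subspaceT.
have {}fN x : dom Om x -> `|f x| <= N + 1.
  move=> Omx; apply: (fN (N + 1)); rewrite ?ltrDl//.
  exists x => //; move: Omx => /OmM.
  case: x => x y; rewrite prod_normE /= ge_max => /andP[xM yM].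
  by split; rewrite /= in_itv/= -ler_norml.
have p2 : (1 <= 2%:E :> \bar R)%E by rewrite lee_fin ler1n.
apply: (@Lfun_subset _ _ _ mu _ _ p2 (leey 1) mu_dom_fin (leey _)).
rewrite inE; apply/andP; split; rewrite inE//= /finite_norm unlock /Lnorm.
case: ifP => // _; apply: (@le_lt_trans _ _ (N + 1)%:E); last by rewrite ltry.
apply/ess_supP.
exists (~` (Om : set plane)); split.
- by apply: measurableC; exact: open_measurable_plane (@dom_open _ Om).
- by rewrite /= /mu_dom /mrestr setICl measure0.
- by move=> x /= + Omx; apply; rewrite lee_fin; exact: fN.
Qed.


(* An element of H^1 is carried as a representative (u, Du) of a
   square-integrable function with its square-integrable weak gradient. Two
   representatives that agree almost everywhere in the domain are at distance
   0 for the H^1 seminorm below; they have the same traces and the same image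
   under every functional considered. *)
Definition preH1 : Type := ((R * R -> R) * ('I_2 -> R * R -> R))%type.
HB.instance Definition _ := GRing.Lmodule.on preH1.

Definition weak_gradient (u : preH1) : Prop :=
  forall eta, test_function Om eta -> forall i,
    \int[mu]_x (u.1 x * partial i eta x) = - \int[mu]_x (u.2 i x * eta x).

Definition is_H1 : {pred preH1} := fun u =>
  `[< [/\ u.1 \in Lfun mu 2%:E,
          forall i, u.2 i \in Lfun mu 2%:E
        & weak_gradient u] >].

Lemma Lfun2D (a : R) (f g : R * R -> R) :
  f \in Lfun mu 2%:E -> g \in Lfun mu 2%:E -> a *: f + g \in Lfun mu 2%:E.
Proof.
have p2 : (1 <= 2%:E :> \bar R)%E by rewrite lee_fin ler1n.
by move=> Lf Lg; have [_] := Lfun_submod_closed mu p2; apply.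
Qed.

Lemma Lfun2M_integrable (f g : R * R -> R) :
  f \in Lfun mu 2%:E -> g \in Lfun mu 2%:E ->
  mu.-integrable [set: plane] (EFin \o (fun x => f x * g x)).
Proof. by move=> Lf Lg; apply/Lfun1_integrable; exact: Lfun2_mul_Lfun1. Qed.

Lemma Rintegral_lin (a : R) (f g h : R * R -> R) :
  f \in Lfun mu 2%:E -> g \in Lfun mu 2%:E -> h \in Lfun mu 2%:E ->
  \int[mu]_x ((a *: f + g) x * h x) =
  a * \int[mu]_x (f x * h x) + \int[mu]_x (g x * h x).
Proof.
move=> Lf Lg Lh.
rewrite -RintegralZl//; last exact: Lfun2M_integrable.
rewrite -RintegralD//.
- by apply: eq_Rintegral => x _; rewrite mulrDl mulrA.
- have : mu.-integrable [set: plane]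
      (EFin \o (fun x => (a *: f + 0) x * h x)).
    apply: Lfun2M_integrable => //; apply: Lfun2D => //.
    exact: continuous_Lfun2 (@cst_continuous _ _ 0).
  by apply: eq_integrable => // x _ /=; rewrite addr0 mulrA.
- exact: Lfun2M_integrable.
Qed.

Lemma is_H1_submod_closed : submod_closed is_H1.
Proof.
have L0 : (0 : R * R -> R) \in Lfun mu 2%:E.
  exact: continuous_Lfun2 (@cst_continuous _ _ 0).
split.
  apply/asboolP; split => // eta _ i /=.
  by under eq_Rintegral do rewrite mul0r;
     under [in RHS]eq_Rintegral do rewrite mul0r;
     rewrite Rintegral_cst// mul0r oppr0.
move=> a u v /asboolP[u1 u2 uw] /asboolP[v1 v2 vw].
apply/asboolP; split => [|i|eta teta i] /=; [exact: Lfun2D|exact: Lfun2D|].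
have [seta _ _] := teta.
rewrite !Rintegral_lin ?uw ?vw//; try exact: (continuous_Lfun2 (seta 0)).
  by rewrite opprD mulrN.
by apply: continuous_Lfun2; case: (seta 1) => _ _; apply.
Qed.

HB.instance Definition _ :=
  GRing.isSubmodClosed.Build R preH1 is_H1 is_H1_submod_closed.

Record H1 := MkH1 { H1_val :> preH1; H1P : H1_val \in is_H1 }.
HB.instance Definition _ := [isSub for H1_val].
HB.instance Definition _ := [Choice of H1 by <:].
HB.instance Definition _ := [SubChoice_isSubLmodule of H1 by <:].

Definition fct (u : H1) : R * R -> R := (u : preH1).1.
Definition grad (u : H1) : 'I_2 -> R * R -> R := (u : preH1).2.

Definition H1_dot (u v : H1) : R :=
  \int[mu]_x (fct u x * fct v x + \sum_i grad u i x * grad v i x).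

Definition H1_norm (u : H1) : R := Num.sqrt (H1_dot u u).

(* "u = 0 at Gam": u is an H^1-limit of smooth functions of the plane that
   vanish in a neighbourhood of closure Gam. *)
Definition zero_at (Gam : set (R * R)) : {pred H1} := fun u =>
  `[< forall e : R, 0 < e -> exists z : H1,
      [/\ smooth (fct z),
          forall x, closure Gam x -> \forall y \near x, fct z y = 0
        & H1_norm (u - z) < e] >].

Lemma fct_lin (a : R) (u v : H1) : fct (a *: u + v) = a *: fct u + fct v.
Proof. by []. Qed.

Lemma H1_dotC (u v : H1) : H1_dot u v = H1_dot v u.
Proof.
apply: eq_Rintegral => x _; rewrite mulrC; congr +%R.
by apply: eq_bigr => i _; rewrite mulrC.
Qed.

Lemma H1_dotE (u v : H1) : H1_dot u v =
  \int[mu]_x (fct u x * fct v x) +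
  (\int[mu]_x (grad u 0 x * grad v 0 x) +
   \int[mu]_x (grad u 1 x * grad v 1 x)).
Proof.
have [u1 u2 _] := asboolW (H1P u); have [v1 v2 _] := asboolW (H1P v).
have iD i := Lfun2M_integrable (u2 i) (v2 i).
rewrite -(RintegralD _ (iD 0) (iD 1))// -RintegralD//.
- apply: eq_Rintegral => x _; rewrite big_ord_recl big_ord1.
  by rewrite (_ : lift _ _ = 1)//; exact: val_inj.
- exact: Lfun2M_integrable.
- exact: eq_integrable (integrableD _ (iD 0) (iD 1)).
Qed.

Lemma H1_dot_lin (a : R) (u v w : H1) :
  H1_dot (a *: u + v) w = a * H1_dot u w + H1_dot v w.
Proof.
have [u1 u2 _] := asboolW (H1P u); have [v1 v2 _] := asboolW (H1P v).
have [w1 w2 _] := asboolW (H1P w).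
rewrite !H1_dotE /fct /grad /=.
rewrite !Rintegral_lin//; ring.
Qed.

Lemma H1_dot_ge0 (u : H1) : 0 <= H1_dot u u.
Proof.
apply: Rintegral_ge0 => x _; rewrite addr_ge0 ?sqr_ge0//.
by apply: sumr_ge0 => i _; exact: sqr_ge0.
Qed.

Lemma H1_dot_le (a : R) (u v : H1) :
  H1_dot (a *: u + v) (a *: u + v) <=
  2 * (a ^+ 2 * H1_dot u u + H1_dot v v).
Proof.
have := H1_dot_ge0 (a *: u + -1 *: v).
have -> : a *: u + v = a *: u + 1 *: v by rewrite scale1r.
have lin b c (x y : H1) :
    H1_dot (b *: u + c *: v) (b *: u + c *: v) =
    b ^+ 2 * H1_dot u u + 2 * b * c * H1_dot u v + c ^+ 2 * H1_dot v v.
  have lin0 (t z : H1) : H1_dot (c *: t) z = c * H1_dot t z.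
    rewrite -[c *: t]addr0 H1_dot_lin.
    suff -> : H1_dot 0 z = 0 by rewrite addr0.
    by rewrite -[0 in LHS](subrr 0) -scaleN1r addrC H1_dot_lin mulN1r addrC subrr.
  rewrite H1_dot_lin lin0 !(H1_dotC _ (_ + _)) !H1_dot_lin !lin0.
  rewrite (H1_dotC v u); ring.
rewrite !lin//; lra.
Qed.

Lemma zero_at_submod_closed (Gam : set (R * R)) :
  submod_closed (zero_at Gam).
Proof.
split.
  apply/asboolP => e e0; exists 0; split.
  - by move=> n; exact: Cn_0.
  - by move=> x _; apply: (@filterE _ (nbhs (x : R * R))).
  - by rewrite subrr /H1_norm (_ : H1_dot 0 0 = 0) ?sqrtr0//;
      rewrite -[X in H1_dot X 0](subrr 0) -scaleN1r addrC H1_dot_lin;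
      rewrite mulN1r addrC subrr.
move=> a u v /asboolP u0 /asboolP v0; apply/asboolP => e e0.
pose d := e / (2 * (1 + `|a|)).
have a0 : 0 < 2 * (1 + `|a|) by rewrite mulr_gt0// ltr_pwDl.
have d0 : 0 < d by rewrite divr_gt0.
have [z [sz zG uz]] := u0 _ d0; have [w [sw wG vw]] := v0 _ d0.
exists (a *: z + w); split.
- by move=> n; rewrite fct_lin; exact: (Cn_lin a (sz n) (sw n)).
- move=> x Gx; apply: filterS2 (zG x Gx) (wG x Gx) => y zy wy.
  by rewrite fct_lin -[LHS]/(a * fct z y + fct w y) zy wy mulr0 addr0.
have -> : a *: u + v - (a *: z + w) = a *: (u - z) + (v - w).
  by rewrite scalerBr opprD addrACA.
have sqlt (t : H1) : H1_norm t < d -> H1_dot t t < d ^+ 2.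
  move=> td; rewrite -(sqr_sqrtr (H1_dot_ge0 t)) -/(H1_norm t).
  by rewrite ltr_pXn2r ?nnegrE ?sqrtr_ge0 ?(ltW d0).
rewrite -(ltr_pXn2r (n := 2))// ?nnegrE ?sqrtr_ge0 ?(ltW e0)//.
rewrite sqr_sqrtr ?H1_dot_ge0//.
apply: (le_lt_trans (H1_dot_le _ _ _)).
have -> : e = 2 * (1 + `|a|) * d by rewrite /d mulrC divfK// gt_eqF.
have := sqlt _ uz; have := sqlt _ vw.
have := H1_dot_ge0 (u - z); have := H1_dot_ge0 (v - w).
move: (H1_dot (u - z) _) (H1_dot (v - w) _) => p q q0 p0 qd pd.
have a2 : a ^+ 2 = `|a| ^+ 2 by rewrite real_normK// num_real.
have ap : a ^+ 2 * p <= `|a| ^+ 2 * d ^+ 2.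
  by rewrite a2 ler_wpM2l// ltW.
have ad : 0 <= `|a| * d ^+ 2 by rewrite mulr_ge0// ltW// exprn_gt0.
nra.
Qed.

HB.instance Definition _ (Gam : set (R * R)) :=
  GRing.isSubmodClosed.Build R H1 (zero_at Gam) (zero_at_submod_closed Gam).

Record H1_0 (Gam : set (R * R)) :=
  MkH1_0 { H1_0_val :> H1; H1_0P : H1_0_val \in zero_at Gam }.
HB.instance Definition _ (Gam : set (R * R)) := [isSub for @H1_0_val Gam].
HB.instance Definition _ (Gam : set (R * R)) := [Choice of H1_0 Gam by <:].
HB.instance Definition _ (Gam : set (R * R)) :=
  [SubChoice_isSubLmodule of H1_0 Gam by <:].

Section Trace.
Variable Gam : set (R * R).

Definition same_trace (u v : H1) : bool := u - v \in zero_at Gam.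

Lemma same_trace_refl : reflexive same_trace.
Proof. by move=> u; rewrite /same_trace subrr rpred0. Qed.

Lemma same_trace_sym : symmetric same_trace.
Proof. by move=> u v; rewrite /same_trace -opprB rpredN. Qed.

Lemma same_trace_trans : transitive same_trace.
Proof.
by move=> v u w uv vw; have := rpredD uv vw; rewrite addrA subrK.
Qed.

Canonical same_trace_equiv :=
  EquivRel same_trace same_trace_refl same_trace_sym same_trace_trans.

(* H^{1/2}(Gam), as the range of the trace operator: H^1 modulo the functions
   vanishing at Gam. *)
Definition H12 := {eq_quot same_trace}%qT.
HB.instance Definition _ := Choice.on H12.
HB.instance Definition _ := EqQuotient.on H12.

Definition trace (u : H1) : H12 := \pi_(H12)%qT u.

End Trace.

Section Dual.
Variables Gam Gam' : set (R * R).

(* Gam' is the rest of the boundary. The elements of H^{1/2}_00(Gam) are the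
   traces at Gam of the H^1 functions vanishing at Gam', so its dual consists
   of the bounded functionals on these functions that depend on the trace at
   Gam only. *)
Definition is_dual : {pred H1_0 Gam' -> R} := fun phi =>
  `[< [/\ forall (a : R) (u v : H1_0 Gam'),
            phi (a *: u + v) = a * phi u + phi v,
          exists C : R, forall u : H1_0 Gam', `|phi u| <= C * H1_norm u
        & forall u : H1_0 Gam', (u : H1) \in zero_at Gam -> phi u = 0] >].

Lemma is_dual_submod_closed : submod_closed is_dual.
Proof.
split.
  apply/asboolP; split => [a u v||//]; first by rewrite mulr0 addr0.
  by exists 0 => u; rewrite normr0 mul0r.
move=> a f g /asboolP[fl [C fC] f0] /asboolP[gl [D gD] g0].
apply/asboolP; split.
- move=> b u v; rewrite -![(a *: f + g) _]/(a * f _ + g _) fl gl; ring.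
- exists (`|a| * C + D) => u; rewrite -[(a *: f + g) _]/(a * f _ + g _).
  rewrite mulrDl -mulrA (le_trans (ler_normD _ _))// normrM.
  by rewrite lerD// ler_wpM2l.
- move=> u uG; rewrite -[(a *: f + g) _]/(a * f _ + g _).
  by rewrite f0// g0// mulr0 addr0.
Qed.

HB.instance Definition _ := GRing.isSubmodClosed.Build R (H1_0 Gam' -> R)
  is_dual is_dual_submod_closed.

Record H00_dual :=
  MkH00_dual { H00_dual_val :> H1_0 Gam' -> R;
               H00_dualP : H00_dual_val \in is_dual }.
HB.instance Definition _ := [isSub for H00_dual_val].
HB.instance Definition _ := [Choice of H00_dual by <:].
HB.instance Definition _ := [SubChoice_isSubLmodule of H00_dual by <:].

End Dual.

Section Problem.
Variable A : R * R -> 'M[R]_2.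

Definition bounded_coef : Prop :=
  forall i j, (fun x => A x i j) \in Lfun mu +oo%E.

Definition elliptic (alpha : R) : Prop :=
  {ae mu, forall x, forall xi : 'cV[R]_2, xi != 0 ->
    alpha * \sum_i xi i 0 ^+ 2 < (xi^T *m A x *m xi) 0 0}.

Definition energy (u : H1) (g : 'I_2 -> R * R -> R) : R :=
  \int[mu]_x \sum_i \sum_j A x i j * grad u j x * g i x.

(* P u = 0 in the domain, in the sense of distributions. *)
Definition P_harmonic (u : H1) : Prop :=
  forall eta, test_function Om eta -> energy u (fun i => partial i eta) = 0.

(* By Green's formula, the conormal derivative of a solution u at Gam acts on
   the functions v vanishing on the rest Gam' of the boundary as the energy
   form. *)
Definition conormal Gam Gam' (u : H1) (phi : H00_dual Gam Gam') : Prop :=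
  forall v : H1_0 Gam', energy u (grad v) = phi v.

(* P w = 0, w = f at GamD, conormal derivative phi at GamN. *)
Definition mixed_sol GamD GamN (f : H12 GamD) (phi : H00_dual GamN GamD)
    (w : H1) : Prop :=
  [/\ P_harmonic w, trace GamD w = f & conormal w phi].

Definition mixed_solvable GamD GamN : Prop :=
  forall (f : H12 GamD) (phi : H00_dual GamN GamD),
    exists w, mixed_sol f phi w.

Variables Gam1 Gam2 : set (R * R).

Notation HH := (H00_dual Gam2 Gam1).

Definition cauchy_sol (f : H12 Gam1) (g : H00_dual Gam1 Gam2) (u : H1) : Prop :=
  [/\ P_harmonic u, trace Gam1 u = f & conormal u g].

Definition consistent f g : Prop := exists u, cauchy_sol f g u.

(* Where the mixed problems are solvable, the default value of xget is not
   used. Solutions with the same data differ by a function with zero gradient,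
   so the values of T_op and star_dot do not depend on the choices made. *)
Definition L_n (f : H12 Gam1) (phi : HH) : H12 Gam2 :=
  trace Gam2 (xget 0 (mixed_sol f phi)).

Definition L_d (g : H00_dual Gam1 Gam2) (psi : H12 Gam2) : HH :=
  xget 0 (conormal (xget 0 (mixed_sol psi g))).

Definition T_op f g : HH -> HH := L_d g \o L_n f.

Definition z_data f g : HH := T_op f g 0.

(* The linear part of the affine map T_op f g. *)
Definition T_lin f g (phi : HH) : HH := T_op f g phi - z_data f g.

Definition W_sol (phi : HH) : H1 := xget 0 (mixed_sol (trace Gam1 0) phi).

Definition star_dot (phi psi : HH) : R :=
  \int[mu]_x \sum_i grad (W_sol phi) i x * grad (W_sol psi) i x.

Definition star_norm (phi : HH) : R := Num.sqrt (star_dot phi phi).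

(* The iterates are numbered from 1; the value at k = 0 is not used. *)
Definition iterates f g (phi1 z : HH) (k : nat) : HH :=
  iter k.-1 (fun phi => T_lin f g phi + z) phi1.

Definition discrepancy f g (phi1 z : HH) (k : nat) : R :=
  let phi := iterates f g phi1 z k in star_norm (z - (phi - T_lin f g phi)).

Definition stopping_index f g (phi1 z : HH) (c eps : R) (k : nat) : Prop :=
  [/\ (0 < k)%N, discrepancy f g phi1 z k <= c * eps
    & forall j, (0 < j)%N -> discrepancy f g phi1 z j <= c * eps ->
        (k <= j)%N].

End Problem.

End Sobolev.

(* Main.v *)
Require Import Defs.
From mathcomp Require Import all_boot all_order all_algebra generic_quotient.
From mathcomp Require Import ring lra.
From mathcomp Require Import all_classical all_reals all_analysis.
From mathcomp Require Import measurable_realfun ess_sup_inf.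
Import Order.TTheory GRing.Theory Num.Theory numFieldNormedType.Exports.
Local Open Scope classical_set_scope.
Local Open Scope ring_scope.

Set Implicit Arguments.
Unset Strict Implicit.
Unset Printing Implicit Defensive.

(** The estimate is a Hilbert space argument about a linear, self-adjoint,
    non-negative and non-expansive T. Consistency of the Cauchy data gives a
    fixed point phibar of the affine operator, so z = phibar - T phibar. The
    residual z_eps - (I - T) phi_k of the perturbed iteration equals
      T^(k-1) (z_eps - z) + T^(k-1) (I - T) e,   e = phibar - phi_1.
    The first term is at most eps. For the second, Cauchy-Schwarz for the form
    <T u, v> yields T^2 <= T ([dot_T_le]), hence |u - T u|^2 is bounded by
    |u|^2 - |T u|^2 ([dot_defect_le]); summing along the orbit of e gives
    k |T^(k-1) (I - T) e|^2 <= |e|^2 ([iter_defect_decay]). The discrepancy is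
    therefore at most mu eps as soon as k (mu - 1)^2 eps^2 >= |e|^2, uniformly
    in z_eps ([discrepancy_principle]).

    What remains is to see that the concrete operator has this form: star_dot
    is bilinear, T_lin is linear, and consistent data give a fixed point.
    All three follow from one principle. By ellipticity, a function d that
    vanishes at the Dirichlet part and has zero conormal derivative at the
    Neumann part has zero Dirichlet integral ([mixed_unique]). As the
    coefficients are bounded, its energy with every function then vanishes
    ([energy_null]), so d changes neither star_dot nor any conormal derivative.
    The trace of d on the other part of the boundary may be nonzero, but
    [conormal_transfer] shows that this ambiguity does not survive the second
    mixed problem. Since the operators are defined by choosing solutions, one
    must also know that conormal derivatives exist as bounded functionals:
    [conormal_exists]. *)

(** * Fixed point iteration in a semi-inner product space *)

Lemma quadratic_ge0_discriminant {R : realFieldType} (a b c : R) :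
  0 <= a -> (forall t, 0 <= t ^+ 2 * a + 2 * t * b + c) -> b ^+ 2 <= a * c.
Proof.
move=> a0 h; have [a_eq0|a_neq0] := eqVneq a 0.
  have [->|b0] := eqVneq b 0; first by rewrite a_eq0 mul0r expr0n.
  have := h (- (c + 1) / (2 * b)).
  have -> : 2 * (- (c + 1) / (2 * b)) * b = - (c + 1) by field.
  by rewrite a_eq0 mulr0; lra.
have := h (- b / a).
have -> : (- b / a) ^+ 2 * a + 2 * (- b / a) * b + c = c - b ^+ 2 / a by field.
by rewrite subr_ge0 ler_pdivrMr ?lt_def ?a_neq0// mulrC.
Qed.

Definition semi_inner {R : realType} {V : lmodType R} (dot : V -> V -> R) :=
  [/\ forall a u v w, dot (a *: u + v) w = a * dot u w + dot v w,
      forall u v, dot u v = dot v u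
    & forall u, 0 <= dot u u].

Definition seminorm {R : realType} {V : lmodType R} (dot : V -> V -> R)
  (u : V) : R := Num.sqrt (dot u u).

Section SemiInner.
Variables (R : realType) (V : lmodType R) (dot : V -> V -> R).
Hypothesis dotP : semi_inner dot.

Let dot_lin a u v w : dot (a *: u + v) w = a * dot u w + dot v w.
Proof. by case: dotP. Qed.

Lemma dotC u v : dot u v = dot v u.
Proof. by case: dotP. Qed.

Lemma dot_ge0 u : 0 <= dot u u.
Proof. by case: dotP. Qed.

Lemma dotDl u v w : dot (u + v) w = dot u w + dot v w.
Proof. by rewrite -[u]scale1r dot_lin mul1r scale1r. Qed.

Lemma dotZl a u w : dot (a *: u) w = a * dot u w.
Proof.
have d0 : dot 0 w = 0 by apply: (addrI (dot 0 w)); rewrite -dotDl !addr0.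
by rewrite -[a *: u]addr0 dot_lin d0 addr0.
Qed.

Lemma dotBl u v w : dot (u - v) w = dot u w - dot v w.
Proof. by rewrite dotDl -scaleN1r dotZl mulN1r. Qed.

Lemma dot_sqrD u v : dot (u + v) (u + v) = dot u u + 2 * dot u v + dot v v.
Proof.
rewrite dotDl (dotC u (_ + _)) (dotC v (_ + _)) !dotDl (dotC v u); ring.
Qed.

Lemma dot_sqrB u v : dot (u - v) (u - v) = dot u u - 2 * dot u v + dot v v.
Proof.
rewrite dotBl (dotC u (_ - _)) (dotC v (_ - _)) !dotBl (dotC v u); ring.
Qed.

Lemma cauchy_schwarz u v : dot u v ^+ 2 <= dot u u * dot v v.
Proof.
apply: quadratic_ge0_discriminant (dot_ge0 u) _ => t.
have := dot_ge0 (t *: u + v).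
by rewrite dot_sqrD !dotZl (dotC u (t *: u)) dotZl mulrA !mulrA -expr2.
Qed.

Lemma dot_null u v : dot u u = 0 -> dot u v = 0.
Proof.
move=> uu; apply/eqP; rewrite -sqrf_eq0 eq_le sqr_ge0 andbT.
by rewrite (le_trans (cauchy_schwarz u v))// uu mul0r.
Qed.

Lemma seminormD u v : seminorm dot (u + v) <= seminorm dot u + seminorm dot v.
Proof.
rewrite -(@ler_pXn2r _ 2)// ?nnegrE ?addr_ge0 ?sqrtr_ge0//.
rewrite sqrrD !sqr_sqrtr ?dot_ge0// dot_sqrD lerD2r lerD2l.
rewrite mulr_natl lerMn2r/= -sqrtrM ?dot_ge0//.
by rewrite (le_trans (ler_norm _))// -sqrtr_sqr ler_wsqrtr// cauchy_schwarz.
Qed.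

End SemiInner.

Section Iteration.
Variables (R : realType) (V : lmodType R) (dot : V -> V -> R) (T : V -> V).
Hypothesis dotP : semi_inner dot.
Hypothesis T_lin : forall a u v, T (a *: u + v) = a *: T u + T v.
Hypothesis T_selfadj : forall u v, dot (T u) v = dot u (T v).
Hypothesis T_nonneg : forall u, 0 <= dot (T u) u.
Hypothesis T_nonexp : forall u, seminorm dot (T u) <= seminorm dot u.

Let TD u v : T (u + v) = T u + T v.
Proof. by rewrite -[u]scale1r T_lin !scale1r. Qed.

Let TB u v : T (u - v) = T u - T v.
Proof. by rewrite addrC -scaleN1r T_lin scaleN1r addrC. Qed.

Let T_nonexp_sqr u : dot (T u) (T u) <= dot u u.
Proof.
have := T_nonexp u; rewrite /seminorm -(@ler_pXn2r _ 2)// ?nnegrE ?sqrtr_ge0//.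
by rewrite !sqr_sqrtr ?(dot_ge0 dotP).
Qed.

(** For a self-adjoint T with 0 <= T <= 1 this is T^2 <= T. Instead
    of a square root of T, Cauchy-Schwarz for the form <T u, v> serves: applied
    to u and T u it gives |T u|^4 <= <T u, u> <T (T u), T u>, and the last
    factor is at most |T u|^2 because T is non-expansive. *)
Lemma dot_T_le u : dot (T u) (T u) <= dot (T u) u.
Proof.
have TP : semi_inner (fun u v => dot (T u) v).
  split=> [a x y z|x y|//]; last by rewrite T_selfadj (dotC dotP).
  by case: dotP => lin _ _; rewrite T_lin lin.
have form_le x : dot (T x) x <= dot x x.
  rewrite -(@ler_pXn2r _ 2)// ?nnegrE ?(dot_ge0 dotP)//.
  rewrite (le_trans (cauchy_schwarz dotP _ _))// expr2.
  by rewrite ler_wpM2r ?(dot_ge0 dotP).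
have [->|Tu0] := eqVneq (dot (T u) (T u)) 0; first exact: T_nonneg.
have Tu_gt0 : 0 < dot (T u) (T u) by rewrite lt_def Tu0 (dot_ge0 dotP).
rewrite -(ler_pM2r Tu_gt0) -expr2.
apply: le_trans (cauchy_schwarz TP u (T u)) _.
by rewrite ler_wpM2l.
Qed.

(** This is where T^2 <= T enters: |u - T u|^2 = |u|^2 - 2 <T u, u> + |T u|^2,
    and the right-hand side telescopes along the orbit of u. *)
Lemma dot_defect_le u :
  dot (u - T u) (u - T u) <= dot u u - dot (T u) (T u).
Proof.
by rewrite (dot_sqrB dotP) (dotC dotP u (T u)); have := dot_T_le u; lra.
Qed.

Lemma iter_TB n u v : iter n T (u - v) = iter n T u - iter n T v.
Proof. by elim: n => //= n ->; rewrite TB. Qed.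

Lemma iter_TD n u v : iter n T (u + v) = iter n T u + iter n T v.
Proof. by elim: n => //= n ->; rewrite TD. Qed.

(** The squared norms of the defects of u, T u, T (T u), ... decrease and, by
    telescoping, their sum is at most |u|^2. *)
Lemma iter_defect_decay n u :
  n.+1%:R * dot (iter n T (u - T u)) (iter n T (u - T u)) <= dot u u.
Proof.
pose q m := dot (iter m T (u - T u)) (iter m T (u - T u)).
pose s m := dot (iter m T u) (iter m T u).
have qs m : q m <= s m - s m.+1.
  by rewrite /q iter_TB -iterSr; exact: dot_defect_le.
suff : n.+1%:R * q n + s n.+1 <= dot u u.
  by apply: le_trans; rewrite lerDl (dot_ge0 dotP).
elim: n => [|n ih]; first by have := qs 0; rewrite /s/= mul1r; lra.
have qn : n.+1%:R * q n.+1 <= n.+1%:R * q n.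
  by rewrite ler_wpM2l//; exact: T_nonexp_sqr.
have := qs n.+1; rewrite -natr1 mulrDl mul1r; move: qn ih.
move: (n.+1%:R * q n.+1) (n.+1%:R * q n) => a b; lra.
Qed.

Lemma seminorm_iter n u : seminorm dot (iter n T u) <= seminorm dot u.
Proof. by elim: n => //= n; apply: le_trans. Qed.

(** The affine part cancels in a residual, so that each iteration step
    applies T to the residual. *)
Lemma residual_iter (phi1 z : V) n :
  let phi := iter n (fun phi => T phi + z) phi1 in
  z - (phi - T phi) = iter n T (z - (phi1 - T phi1)).
Proof.
elim: n => [|n] //=; set phi := iter n _ _ => <-.
rewrite !opprB !(TB, TD) addrC opprD [in LHS]addrA subrK.
by rewrite [RHS]addrA (addrC (T z)).
Qed.

(** The residual after n steps is T^n (ze - z) + T^n (e - T e), where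
    e = phibar - phi1 is the initial error. The first term never exceeds eps;
    the second falls below (mu - 1) eps once (n + 1) (mu - 1)^2 eps^2 reaches
    |e|^2, and this bound on n does not depend on ze. *)
Lemma discrepancy_principle (phibar phi1 z : V) (mu : R) :
  1 < mu -> z = phibar - T phibar ->
  let iterate ze k := iter k.-1 (fun phi => T phi + ze) phi1 in
  let discr ze k :=
    seminorm dot (ze - (iterate ze k - T (iterate ze k))) in
  exists C : R, \forall eps \near 0^'+, forall ze : V,
    seminorm dot (ze - z) <= eps ->
    exists k : nat,
      [/\ (0 < k)%N, discr ze k <= mu * eps
        & forall j, (0 < j)%N -> discr ze j <= mu * eps -> (k <= j)%N]
      /\ k%:R <= C * eps ^- 2.
Proof.
move=> mu1 zE iterate discr.
pose e := phibar - phi1; pose E := dot e e / (mu - 1) ^+ 2.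
have m0 : 0 < mu - 1 by rewrite subr_gt0.
have E0 : 0 <= E by rewrite divr_ge0 ?(dot_ge0 dotP)// ltW// exprn_gt0.
(* The 1 pays for rounding E / eps^2 up to an integer: 1 <= eps^-2 when
   eps <= 1. *)
exists (E + 1); near=> eps => ze zze.
have eps0 : 0 < eps by near: eps; exact: nbhs_right_gt.
have eps1 : eps <= 1 by near: eps; exact: nbhs_right_le.
have eps2 : 0 < eps ^+ 2 by rewrite exprn_gt0.
pose n := Num.truncn (E / eps ^+ 2).
have En : E / eps ^+ 2 < n.+1%:R by exact: truncnS_gt.
have stop : discr ze n.+1 <= mu * eps.
  rewrite /discr /iterate residual_iter.
  have -> : ze - (phi1 - T phi1) = (ze - z) + (e - T e).
    have -> : e - T e = z - (phi1 - T phi1).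
      rewrite zE /e TB opprB opprB.
      by rewrite [LHS]addrACA [RHS]addrACA (addrC (- phi1)).
    by rewrite addrA subrK.
  rewrite iter_TD (le_trans (seminormD dotP _ _))//.
  have -> : mu * eps = eps + (mu - 1) * eps by ring.
  apply: lerD; first exact: le_trans (seminorm_iter _ _) zze.
  have n0 : 0 < n.+1%:R :> R by [].
  rewrite -(@ler_pXn2r _ 2)// ?nnegrE ?sqrtr_ge0//;
    last by rewrite mulr_ge0 ?(ltW m0) ?(ltW eps0).
  rewrite sqr_sqrtr ?(dot_ge0 dotP)// -(ler_pM2l n0).
  rewrite (le_trans (iter_defect_decay _ _))// exprMn (mulrC (_ ^+ 2)).
  move: En; rewrite /E ltr_pdivrMr// ltr_pdivrMr ?exprn_gt0// => /ltW.
  by rewrite -mulrA.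
have [k /andP[k0 kd] kmin] :=
  ex_minnP (ex_intro
    (fun k => (0 < k)%N && (discr ze k <= mu * eps)) n.+1 stop).
exists k; split; first by split=> // j j0 jd; apply: kmin; rewrite j0.
have : (k <= n.+1)%N by exact: kmin.
rewrite -(@ler_nat R) => /le_trans; apply.
rewrite -natr1 mulrDl mul1r lerD//.
  by rewrite truncn_le// divr_ge0// ltW.
by rewrite invf_ge1// expr_le1// ltW.
Unshelve. all: by end_near. Qed.

End Iteration.

(** * Integrals under almost everywhere bounds *)

Section AlmostEverywhere.
Context d (T : measurableType d) (R : realType).
Context (mu : {measure set T -> \bar R}).

(** The almost everywhere property P is kept apart from the inequality, so
    that one hypothesis on the coefficients serves for many integrands. *)
Lemma ae_Rintegral_ge0 (P : T -> Prop) (f : T -> R) :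
  measurable_fun [set: T] f -> {ae mu, forall x, P x} ->
  (forall x, P x -> 0 <= f x) -> 0 <= \int[mu]_x f x.
Proof.
move=> mf aeP f0.
suff -> : \int[mu]_x f x = \int[mu]_x `|f x| by exact: Rintegral_ge0.
congr fine; apply: ae_eq_integral => //.
- exact/measurable_EFinP.
- by apply/measurable_EFinP; exact: measurableT_comp.
- by apply: filterS aeP => x /f0 fx _; rewrite ger0_norm.
Qed.

Lemma ae_le_Rintegral (P : T -> Prop) (f g : T -> R) :
  mu.-integrable [set: T] (EFin \o f) -> mu.-integrable [set: T] (EFin \o g) ->
  {ae mu, forall x, P x} -> (forall x, P x -> f x <= g x) ->
  \int[mu]_x f x <= \int[mu]_x g x.
Proof.
move=> fi gi aeP fg; rewrite -subr_ge0 -RintegralB//.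
apply: ae_Rintegral_ge0 aeP _ => [|x /fg]; last by rewrite subr_ge0.
apply: measurable_funB; apply/measurable_EFinP.
  exact: measurable_int gi.
exact: measurable_int fi.
Qed.

(** The L^infty norm is by definition 0 when the whole space has measure 0, so
    this degenerate case must be treated apart from the essential supremum. *)
Lemma Lfun_infty_ae_bounded (f : T -> R) : f \in Lfun mu +oo%E ->
  measurable_fun [set: T] f /\ exists M : R, {ae mu, forall x, `|f x| <= M}.
Proof.
rewrite inE => /andP[]; rewrite !inE/= => mf foo; split=> //.
move: foo; rewrite /finite_norm unlock /Lnorm.
case: ifPn => [mu0 foo|].
  have M0 : (0 <= ess_sup mu (abse \o (EFin \o f)))%E.
    by apply: ess_sup_gee => //; apply: nearW => x; exact: abse_ge0.
  exists (fine (ess_sup mu (abse \o (EFin \o f)))).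
  have := @ess_sup_ge _ _ _ mu (abse \o (EFin \o f)).
  apply: filterS => x /=.
  by rewrite -lee_fin fineK// ge0_fin_numE.
rewrite -leNgt measure_le0 => /eqP mu0 _.
by exists 0; exists setT; split.
Qed.

Lemma Lfun_infty_mul_integrable (f h : T -> R) : f \in Lfun mu +oo%E ->
  mu.-integrable [set: T] (EFin \o h) ->
  mu.-integrable [set: T] (EFin \o (fun x => f x * h x)).
Proof.
move=> /Lfun_infty_ae_bounded[mf [M fM]] ih.
have mh : measurable_fun [set: T] h.
  by apply/measurable_EFinP; exact: measurable_int ih.
have mfh : measurable_fun [set: T] (fun x => f x * h x).
  by exact: measurable_funM.
apply/integrableP; split; first exact/measurable_EFinP.
have /integrableP[_] := integrableZl measurableT M ih.
apply: le_lt_trans; apply: ae_ge0_le_integral => //.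
- by apply/measurable_EFinP; exact: measurableT_comp.
- apply/measurableT_comp => //; apply: measurable_funeM.
  exact: measurable_int ih.
- apply: filterS fM => x fx _ /=; rewrite lee_fin !normrM ler_wpM2r//.
  by rewrite (le_trans fx)// ler_norm.
Qed.

Lemma Lfun_infty_common_bound (I : finType) (f : I -> T -> R) :
  (forall i, f i \in Lfun mu +oo%E) ->
  exists M : R, {ae mu, forall x, forall i, `|f i x| <= M}.
Proof.
move=> Lf.
have /choice[M fM] : forall i, exists M : R, {ae mu, forall x, `|f i x| <= M}.
  by move=> i; have [] := Lfun_infty_ae_bounded (Lf i).
exists (\sum_i `|M i|).
have : {ae mu, forall x, forall i, `|f i x| <= M i} by apply: filter_forall.
apply: filterS => x fx i; rewrite (le_trans (fx i))//.
rewrite (le_trans (ler_norm _))// (bigD1 i)//= lerDl.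
by apply: sumr_ge0 => j _.
Qed.

End AlmostEverywhere.

(** * The energy form on H^1 *)

Section EnergyForm.
Variables (R : realType) (Om : regular_domain R).
Notation mu := (mu_dom Om).
Notation H1 := (H1 Om).

(** Only semidefinite on H^1: it ignores functions with zero gradient. The
    inner product on the Neumann data is its pullback along W. *)
Definition dirichlet (u v : H1) : R :=
  \int[mu]_x \sum_i grad u i x * grad v i x.

Lemma grad_linE (a : R) (u v : H1) i x :
  grad (a *: u + v) i x = a * grad u i x + grad v i x.
Proof. by []. Qed.

Lemma grad_mul_integrable (u v : H1) i j :
  mu.-integrable [set: _] (EFin \o (fun x => grad u i x * grad v j x)).
Proof.
have [_ u2 _] := asboolW (H1P u); have [_ v2 _] := asboolW (H1P v).
exact: Lfun2M_integrable (u2 i) (v2 j).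
Qed.

Lemma integrable_sum_EFin I (s : seq I) (h : I -> R * R -> R) :
  (forall i, mu.-integrable [set: _] (EFin \o h i)) ->
  mu.-integrable [set: _] (EFin \o (fun x => \sum_(i <- s) h i x)).
Proof.
move=> ih; have : mu.-integrable [set: _] (fun x => \sum_(i <- s) (h i x)%:E).
  by apply: integrable_sum => // i _; exact: ih.
by apply: eq_integrable => // x _ /=; rewrite sumEFin.
Qed.

Lemma dirichlet_integrable (u v : H1) :
  mu.-integrable [set: _] (EFin \o (fun x => \sum_i grad u i x * grad v i x)).
Proof. by apply: integrable_sum_EFin => i; exact: grad_mul_integrable. Qed.

Lemma Rintegral_comb (a : R) (f g : R * R -> R) :
  mu.-integrable [set: _] (EFin \o f) -> mu.-integrable [set: _] (EFin \o g) ->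
  \int[mu]_x (a * f x + g x) = a * \int[mu]_x f x + \int[mu]_x g x.
Proof.
move=> fi gi; have afi := integrableZl measurableT a fi.
by rewrite RintegralD// RintegralZl.
Qed.

Lemma dirichlet_semi_inner : semi_inner dirichlet.
Proof.
split=> [a u v w|u v|u].
- rewrite -Rintegral_comb; last 2 first.
  - exact: dirichlet_integrable.
  - exact: dirichlet_integrable.
  apply: eq_Rintegral => x _; rewrite mulr_sumr -big_split/=.
  by apply: eq_bigr => i _; rewrite mulrDl mulrA.
- by apply: eq_Rintegral => x _; apply: eq_bigr => i _; rewrite mulrC.
- by apply: Rintegral_ge0 => x _; apply: sumr_ge0 => i _; exact: sqr_ge0.
Qed.

Lemma dirichlet_le_H1_norm (u : H1) : seminorm dirichlet u <= H1_norm u.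
Proof.
have [L2u _ _] := asboolW (H1P u).
apply: ler_wsqrtr; rewrite /dirichlet /H1_dot RintegralD//; last 2 first.
- exact: (Lfun2M_integrable L2u L2u).
- exact: dirichlet_integrable.
by rewrite lerDr; apply: Rintegral_ge0 => x _; exact: sqr_ge0.
Qed.

Variables (A : R * R -> 'M[R]_2) (alpha : R).
Hypothesis A_bounded : bounded_coef Om A.
Hypothesis A_elliptic : elliptic Om A alpha.

Lemma energy_integrable (u v : H1) : mu.-integrable [set: _]
  (EFin \o (fun x => \sum_i \sum_j A x i j * grad u j x * grad v i x)).
Proof.
apply: integrable_sum_EFin => i; apply: integrable_sum_EFin => j.
have := Lfun_infty_mul_integrable (A_bounded i j) (grad_mul_integrable u v j i).
by apply: eq_integrable => // x _ /=; rewrite mulrA.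
Qed.

Lemma energy_linl (a : R) (u v w : H1) :
  energy A (a *: u + v) (grad w) =
  a * energy A u (grad w) + energy A v (grad w).
Proof.
rewrite -Rintegral_comb; last 2 first.
- exact: energy_integrable.
- exact: energy_integrable.
apply: eq_Rintegral => x _; rewrite mulr_sumr -big_split/=.
apply: eq_bigr => i _; rewrite mulr_sumr -big_split/=.
by apply: eq_bigr => j _; rewrite grad_linE; ring.
Qed.

Lemma energy_linr (a : R) (u v w : H1) :
  energy A w (grad (a *: u + v)) =
  a * energy A w (grad u) + energy A w (grad v).
Proof.
rewrite -Rintegral_comb; last 2 first.
- exact: energy_integrable.
- exact: energy_integrable.
apply: eq_Rintegral => x _; rewrite mulr_sumr -big_split/=.
apply: eq_bigr => i _; rewrite mulr_sumr -big_split/=.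
by apply: eq_bigr => j _; rewrite grad_linE; ring.
Qed.

Lemma energy_coercive (u : H1) :
  alpha * dirichlet u u <= energy A u (grad u).
Proof.
rewrite /dirichlet -RintegralZl//; last exact: dirichlet_integrable.
have ai := integrableZl measurableT alpha (dirichlet_integrable u u).
apply: (ae_le_Rintegral ai (energy_integrable u u) A_elliptic) => x ell.
pose xi : 'cV[R]_2 := \col_i grad u i x.
have -> : \sum_i \sum_j A x i j * grad u j x * grad u i x =
          (xi^T *m A x *m xi) 0 0.
  rewrite -mulmxA !mxE; apply: eq_bigr => i _.
  rewrite !mxE mulr_sumr; apply: eq_bigr => j _; rewrite !mxE; ring.
have -> : \sum_i grad u i x * grad u i x = \sum_i xi i 0 ^+ 2.
  by apply: eq_bigr => i _; rewrite !mxE.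
have [->|/ell/ltW//] := eqVneq xi 0.
by rewrite mulmx0 mxE big1 ?mulr0// => i _; rewrite mxE expr0n.
Qed.

Lemma sum_sum_prod_le (M : R) (a : 'I_2 -> 'I_2 -> R) (p q : 'I_2 -> R) :
  (forall i j, `|a i j| <= M) ->
  \sum_i \sum_j a i j * p j * q i <=
  M * (\sum_i p i * p i + \sum_i q i * q i).
Proof.
move=> aM.
have M0 : 0 <= M by exact: le_trans (normr_ge0 _) (aM 0 0).
have le_ij i j : a i j * p j * q i <= M / 2 * (p j * p j + q i * q i).
  rewrite (le_trans (ler_norm _))// -mulrA normrM.
  rewrite (le_trans (ler_wpM2r _ (aM i j)))// -mulrA ler_wpM2l//.
  rewrite ler_norml; have := sqr_ge0 (p j + q i); have := sqr_ge0 (p j - q i).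
  by move=> *; apply/andP; split; nra.
have : \sum_i \sum_j a i j * p j * q i <=
       \sum_i \sum_j M / 2 * (p j * p j + q i * q i).
  by apply: ler_sum => i _; apply: ler_sum => j _.
move=> /le_trans; apply; rewrite le_eqVlt; apply/orP; left; apply/eqP.
by rewrite !big_ord_recl !big_ord0; field.
Qed.

Lemma energy_le_sum : exists2 M : R, 0 <= M & forall u v : H1,
  energy A u (grad v) <= M * (dirichlet u u + dirichlet v v).
Proof.
have [M aeM] := Lfun_infty_common_bound
  (fun ij : 'I_2 * 'I_2 => A_bounded ij.1 ij.2).
exists `|M| => // u v.
have iD := integrableD measurableT (dirichlet_integrable u u)
                                   (dirichlet_integrable v v).
rewrite /dirichlet -RintegralD ?dirichlet_integrable// -RintegralZl//.
have iM := integrableZl measurableT `|M| iD.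
apply: (ae_le_Rintegral (energy_integrable u v) iM aeM) => x Mx.
apply: sum_sum_prod_le => i j.
by rewrite (le_trans (Mx (i, j)))// ler_norm.
Qed.

(** The crude bound M (D(u, u) + D(v, v)) on the energy of u and v becomes a
    product bound by scaling v: written for t v, the difference of its two sides
    is a non-negative quadratic in t, so its discriminant is non-positive. *)
Lemma energy_sqr_le : exists M : R, forall u v : H1,
  energy A u (grad v) ^+ 2 <= M * dirichlet u u * dirichlet v v.
Proof.
have [M M0 EM] := energy_le_sum; exists ((2 * M) ^+ 2) => u v.
have DD := dirichlet_semi_inner.
have -> : (2 * M) ^+ 2 * dirichlet u u * dirichlet v v =
  2 ^+ 2 * (M * dirichlet v v * (M * dirichlet u u)) by ring.
have -> : energy A u (grad v) ^+ 2 = 2 ^+ 2 * (energy A u (grad v) / 2) ^+ 2.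
  by field.
rewrite ler_wpM2l// ?sqr_ge0//.
have energyZr (t : R) : energy A u (grad (t *: v)) = t * energy A u (grad v).
  have := energy_linr t v (0 *: v) u; rewrite {1}scale0r addr0 => ->.
  have := energy_linr (-1) v v u; rewrite scaleN1r addNr.
  rewrite mulN1r addNr scale0r => ->.
  by rewrite addr0.
apply: quadratic_ge0_discriminant => [|t].
  by rewrite mulr_ge0 ?(dot_ge0 DD).
have := EM u (- t *: v); rewrite energyZr (dotZl DD) (dotC DD v) (dotZl DD).
by lra.
Qed.

Lemma energy_null (u v : H1) : dirichlet u u = 0 -> energy A u (grad v) = 0.
Proof.
move=> u0; have [M EM] := energy_sqr_le; apply/eqP.
rewrite -sqrf_eq0 eq_le sqr_ge0 andbT (le_trans (EM u v))//.
by rewrite u0 mulr0 mul0r.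
Qed.

(** This makes the energy functional of u an admissible conormal derivative,
    so that L_d never falls back on a default value. *)
Lemma energy_bounded (u : H1) : exists C : R, forall v : H1,
  `|energy A u (grad v)| <= C * H1_norm v.
Proof.
have [M EM] := energy_sqr_le; have DD := dirichlet_semi_inner.
exists (Num.sqrt (`|M| * dirichlet u u)) => v.
have Mu0 : 0 <= `|M| * dirichlet u u by rewrite mulr_ge0 ?(dot_ge0 DD).
apply: (@le_trans _ _ (Num.sqrt (`|M| * dirichlet u u) *
                       seminorm dirichlet v)).
  rewrite -sqrtrM// -sqrtr_sqr ler_wsqrtr// (le_trans (EM u v))//.
  by rewrite !ler_wpM2r ?(dot_ge0 DD)// ler_norm.
by rewrite ler_wpM2l ?sqrtr_ge0// dirichlet_le_H1_norm.
Qed.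

End EnergyForm.

(** * Mixed boundary value problems and the two-step operator *)

Section MixedProblems.
Variables (R : realType) (Om : regular_domain R).
Variables (A : R * R -> 'M[R]_2) (alpha : R).
Hypothesis A_bounded : bounded_coef Om A.
Hypothesis alpha_gt0 : 0 < alpha.
Hypothesis A_elliptic : elliptic Om A alpha.
Notation H1 := (H1 Om).

Lemma trace_eqP (Gam : set (R * R)) (u v : H1) :
  trace Gam u = trace Gam v -> -1 *: v + u \in zero_at Gam.
Proof.
move=> /eqmodP; rewrite /= /same_trace.
by rewrite scaleN1r addrC.
Qed.

Lemma zero_at_lin (Gam : set (R * R)) (a : R) (u v : H1) :
  u \in zero_at Gam -> v \in zero_at Gam -> a *: u + v \in zero_at Gam.
Proof. exact: (zero_at_submod_closed Om Gam).2. Qed.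

Lemma conormal_lin (Gam Gam' : set (R * R)) (a : R) (u v : H1)
  (phi psi : H00_dual Om Gam Gam') :
  conormal A u phi -> conormal A v psi ->
  conormal A (a *: u + v) (a *: phi + psi).
Proof. by move=> cu cv x; rewrite energy_linl// cu cv. Qed.

Lemma conormal_inj (Gam Gam' : set (R * R)) (u : H1)
  (phi psi : H00_dual Om Gam Gam') :
  conormal A u phi -> conormal A u psi -> phi = psi.
Proof.
move=> cphi cpsi; apply/val_inj/funext => v.
exact: eq_trans (esym (cphi v)) (cpsi v).
Qed.

(** The conormal derivative of u at one part of the boundary forces the energy
    functional of u to depend, on functions vanishing at Gam1, only on the
    trace at Gam2: if such a function vanishes at Gam2 as well, its energy
    with u is a value of g on a function of trace zero. *)
Lemma conormal_exists (Gam1 Gam2 : set (R * R)) (g : H00_dual Om Gam1 Gam2)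
  (u : H1) : conormal A u g ->
  exists phi : H00_dual Om Gam2 Gam1, conormal A u phi.
Proof.
move=> ug.
have dualP : (fun v : H1_0 Om Gam1 => energy A u (grad v)) \in
    is_dual Gam2 (Gam' := Gam1).
  apply/asboolP; split.
  - by move=> a v w; rewrite -(energy_linr A_bounded).
  - have [C uC] := energy_bounded A_bounded u.
    by exists C => v; exact: uC.
  - move=> v v0; rewrite (ug (MkH1_0 v0)).
    have [_ _ g0] := asboolW (H00_dualP g).
    by apply: g0; exact: H1_0P.
by exists (MkH00_dual dualP).
Qed.

(** Testing the equation with d itself. When GamD is empty d may be a nonzero
    constant, so that only the gradient of d is determined. *)
Lemma mixed_unique (GamD GamN : set (R * R)) (d : H1) :
  d \in zero_at GamD -> conormal A d (0 : H00_dual Om GamN GamD) ->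
  dirichlet d d = 0.
Proof.
move=> d0 cd; have DD := @dirichlet_semi_inner _ Om.
apply/eqP; rewrite eq_le (dot_ge0 DD) andbT -(pmulr_rle0 _ alpha_gt0).
rewrite (le_trans (energy_coercive A_bounded A_elliptic d))//.
by rewrite (cd (MkH1_0 d0)).
Qed.

Variables Gam1 Gam2 : set (R * R).
Notation HH := (H00_dual Om Gam2 Gam1).

(** Here d and e combine the first-step and the second-step solutions of
    several runs of the two-step operator, in such a way that all data cancel.
    They need not vanish, since constants may appear, but both have zero
    gradient, which is all that the conormal derivative sees. *)
Lemma conormal_transfer (d e : H1) :
  d \in zero_at Gam1 -> conormal A d (0 : HH) ->
  -1 *: d + e \in zero_at Gam2 -> conormal A e (0 : H00_dual Om Gam1 Gam2) ->
  conormal A e (0 : HH).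
Proof.
move=> d0 cd ed0 ce v.
have dd := mixed_unique d0 cd.
have ced : conormal A (-1 *: d + e) (0 : H00_dual Om Gam1 Gam2).
  move=> w; rewrite (energy_linl A_bounded) ce.
  by rewrite (energy_null A_bounded w dd) mulr0 add0r.
have := energy_null A_bounded v (mixed_unique ed0 ced).
by rewrite (energy_linl A_bounded) (energy_null A_bounded v dd) mulr0 add0r.
Qed.

Hypothesis solv12 : mixed_solvable Om A Gam1 Gam2.
Hypothesis solv21 : mixed_solvable Om A Gam2 Gam1.
Variables (f : H12 Om Gam1) (g : H00_dual Om Gam1 Gam2).

(** A run of the two-step operator described by the equations that its two
    intermediate solutions satisfy, free of the choices made in L_n and
    L_d. *)
Definition T_witness (phi : HH) (w v : H1) :=
  [/\ trace Gam1 w = f, conormal A w phi, trace Gam2 v = trace Gam2 w,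
      conormal A v g & conormal A v (T_op A f g phi)].

Lemma T_witness_exists (phi : HH) : exists w v, T_witness phi w v.
Proof.
pose w := xget 0 (mixed_sol A f phi).
have [_ wf wphi] : mixed_sol A f phi w.
  by have [w' sw'] := solv12 f phi; exact: (xgetPex 0 (ex_intro _ w' sw')).
pose v := xget 0 (mixed_sol A (trace Gam2 w) g).
have [_ vw vg] : mixed_sol A (trace Gam2 w) g v.
  have [v' sv'] := solv21 (trace Gam2 w) g.
  exact: (xgetPex 0 (ex_intro _ v' sv')).
exists w, v; split => //.
have [psi vpsi] := conormal_exists vg.
exact: (xgetPex 0 (ex_intro _ psi vpsi)).
Qed.

(** The combination T (a phi + psi) - T psi - a (T phi - T 0) is the conormal
    derivative of the same combination of second-step solutions, and all data
    cancel in that combination. *)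
Lemma T_lin_linear (a : R) (phi psi : HH) :
  T_lin A f g (a *: phi + psi) = a *: T_lin A f g phi + T_lin A f g psi.
Proof.
have [w1 [v1 [w1f cw1 vw1 v1g Tv1]]] := T_witness_exists 0.
have [w2 [v2 [w2f cw2 vw2 v2g Tv2]]] := T_witness_exists phi.
have [w3 [v3 [w3f cw3 vw3 v3g Tv3]]] := T_witness_exists psi.
have [w4 [v4 [w4f cw4 vw4 v4g Tv4]]] := T_witness_exists (a *: phi + psi).
(* The coefficients sum to zero, which cancels the fixed data f and g. *)
pose comb (V : lmodType R) (x1 x2 x3 x4 : V) :=
  - a *: (-1 *: x1 + x2) + (-1 *: x3 + x4).
have ccomb Gam Gam' (u1 u2 u3 u4 : H1) (p1 p2 p3 p4 : H00_dual Om Gam Gam') :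
    conormal A u1 p1 -> conormal A u2 p2 -> conormal A u3 p3 ->
    conormal A u4 p4 -> conormal A (comb _ u1 u2 u3 u4) (comb _ p1 p2 p3 p4).
  move=> c1 c2 c3 c4.
  exact: (conormal_lin _ (conormal_lin _ c1 c2) (conormal_lin _ c3 c4)).
have comb_mem Gam (u1 u2 u3 u4 : H1) : u1 \in zero_at Gam ->
    u2 \in zero_at Gam -> u3 \in zero_at Gam -> u4 \in zero_at Gam ->
    comb _ u1 u2 u3 u4 \in zero_at Gam.
  move=> u10 u20 u30 u40.
  exact: (zero_at_lin _ (zero_at_lin _ u10 u20) (zero_at_lin _ u30 u40)).
have combE (V : lmodType R) (x1 x2 x3 x4 : V) :
    comb V x1 x2 x3 x4 = (x4 - x3) - a *: (x2 - x1).
  by rewrite /comb !scaleN1r scaleNr addrC (addrC (- x1)) (addrC (- x3)).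
have lin2 (V : lmodType R) b (x x' y y' : V) :
    -1 *: (b *: x + y) + (b *: x' + y') =
    b *: (-1 *: x + x') + (-1 *: y + y').
  by rewrite !scalerDr !scalerA (mulrC b) addrACA.
have combD (V : lmodType R) (x1 x2 x3 x4 y1 y2 y3 y4 : V) :
    -1 *: comb V x1 x2 x3 x4 + comb V y1 y2 y3 y4 =
    comb V (-1 *: x1 + y1) (-1 *: x2 + y2) (-1 *: x3 + y3) (-1 *: x4 + y4).
  by rewrite /comb [LHS]lin2 [X in - a *: X + _]lin2 [X in _ + X]lin2.
have d0 : comb _ w1 w2 w3 w4 \in zero_at Gam1.
  by apply: zero_at_lin; apply: trace_eqP; rewrite ?w1f ?w3f.
have cd : conormal A (comb _ w1 w2 w3 w4) (0 : HH).
  suff <- : comb _ 0 phi psi (a *: phi + psi) = 0 by exact: ccomb.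
  by rewrite combE subr0 addrK subrr.
have ce : conormal A (comb _ v1 v2 v3 v4) (0 : H00_dual Om Gam1 Gam2).
  suff <- : comb _ g g g g = 0 by exact: ccomb.
  by rewrite combE !subrr scaler0 subr0.
have ed : -1 *: comb _ w1 w2 w3 w4 + comb _ v1 v2 v3 v4 \in zero_at Gam2.
  rewrite combD; apply: comb_mem; exact: trace_eqP.
have := conormal_inj (conormal_transfer d0 cd ed ce)
  (ccomb _ _ _ _ _ _ _ _ _ _ Tv1 Tv2 Tv3 Tv4).
rewrite combE => /esym/eqP; rewrite subr_eq0 => /eqP.
rewrite /T_lin /z_data => <-.
by rewrite addrA subrK.
Qed.

(** The Cauchy solution u satisfies the equations of both mixed problems, so
    both steps return u up to a function with zero gradient. *)
Lemma T_op_fixpoint (u : H1) (phi : HH) :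
  cauchy_sol A f g u -> conormal A u phi -> T_op A f g phi = phi.
Proof.
move=> [_ uf ug] uphi.
have [w [v [wf cw vw vg Tv]]] := T_witness_exists phi.
have d0 : -1 *: u + w \in zero_at Gam1 by rewrite trace_eqP ?wf.
have cd : conormal A (-1 *: u + w) (0 : HH).
  suff <- : -1 *: phi + phi = 0 by exact: conormal_lin.
  by rewrite scaleN1r addNr.
have ce : conormal A (-1 *: u + v) (0 : H00_dual Om Gam1 Gam2).
  suff <- : -1 *: g + g = 0 by exact: conormal_lin.
  by rewrite scaleN1r addNr.
have ed : -1 *: (-1 *: u + w) + (-1 *: u + v) \in zero_at Gam2.
  have -> : -1 *: (-1 *: u + w) + (-1 *: u + v) = -1 *: w + v.
    by rewrite !scaleN1r opprD opprK addrACA subrr add0r.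
  exact: trace_eqP.
have := conormal_inj (conormal_transfer d0 cd ed ce)
  (conormal_lin (-1) uphi Tv).
by rewrite scaleN1r addrC => /esym/eqP; rewrite subr_eq0 => /eqP.
Qed.

Lemma z_data_range : consistent A f g ->
  exists phibar : HH, z_data A f g = phibar - T_lin A f g phibar.
Proof.
move=> [u fgu]; have [_ _ ug] := fgu.
have [phibar uphi] := conormal_exists ug; exists phibar.
by rewrite /T_lin (T_op_fixpoint fgu uphi) subKr.
Qed.

Lemma W_solP (phi : HH) :
  W_sol A phi \in zero_at Gam1 /\ conormal A (W_sol A phi) phi.
Proof.
have [w sw] := solv12 (trace Gam1 0) phi.
have [_ + cW] := xgetPex 0 (ex_intro _ w sw).
by move=> /trace_eqP; rewrite scaler0 add0r.
Qed.

Lemma star_dot_semi_inner : semi_inner (@star_dot _ Om A Gam1 Gam2).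
Proof.
have DD := @dirichlet_semi_inner _ Om.
split=> [a phi psi chi|phi psi|phi]; last 2 first.
- exact: (dotC DD).
- exact: (dot_ge0 DD).
have [P0 cP] := W_solP phi; have [Q0 cQ] := W_solP psi.
have [S0 cS] := W_solP (a *: phi + psi).
pose d := -1 *: (a *: W_sol A phi + W_sol A psi) + W_sol A (a *: phi + psi).
have d0 : d \in zero_at Gam1.
  apply: zero_at_lin S0; exact: zero_at_lin.
have cd : conormal A d (0 : HH).
  suff <- : -1 *: (a *: phi + psi) + (a *: phi + psi) = 0.
    exact: (conormal_lin _ (conormal_lin _ cP cQ) cS).
  by rewrite scaleN1r addNr.
have := dot_null DD (W_sol A chi) (mixed_unique d0 cd).
rewrite /d (dotDl DD) (dotZl DD) (dotDl DD) (dotZl DD) mulN1r addrC.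
exact: subr0_eq.
Qed.

End MixedProblems.

(** * Stopping index *)

Theorem theorem12 (R : realType) (Om : regular_domain R)
  (Gam1 Gam2 : set (R * R))
  (hdisj : Gam1 `&` Gam2 = set0)
  (hbdry : closure (Gam1 `|` Gam2) = bdry Om)
  (A : R * R -> 'M[R]_2) (alpha : R)
  (hA : bounded_coef Om A) (halpha : 0 < alpha) (hell : elliptic Om A alpha)
  (* solvability of the mixed problems that define L_n, W and L_d *)
  (hsolv12 : mixed_solvable Om A Gam1 Gam2)
  (hsolv21 : mixed_solvable Om A Gam2 Gam1)
  (f : H12 Om Gam1) (g : H00_dual Om Gam1 Gam2)
  (hfg : consistent A f g)
  (hselfadj : forall phi psi : H00_dual Om Gam2 Gam1,
     star_dot A (T_lin A f g phi) psi = star_dot A phi (T_lin A f g psi))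
  (hnonneg : forall phi : H00_dual Om Gam2 Gam1,
     0 <= star_dot A (T_lin A f g phi) phi)
  (hnonexp : forall phi : H00_dual Om Gam2 Gam1,
     star_norm A (T_lin A f g phi) <= star_norm A phi)
  (phi1 : H00_dual Om Gam2 Gam1) (mu : R) (hmu : 1 < mu) :
  exists C : R, \forall eps \near 0^'+,
    forall z_eps : H00_dual Om Gam2 Gam1,
      star_norm A (z_eps - z_data A f g) <= eps ->
      exists k : nat,
        stopping_index A f g phi1 z_eps mu eps k /\ k%:R <= C * eps ^- 2.
Proof.
have [phibar zE] := z_data_range hA halpha hell hsolv12 hsolv21 hfg.
exact: (discrepancy_principle
  (star_dot_semi_inner hA halpha hell hsolv12)
  (T_lin_linear hA halpha hell hsolv12 hsolv21 f g)
  hselfadj hnonneg hnonexp phi1 hmu zE).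
Qed.
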